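(* Let $\varepsilon,\delta\ge 0$, let $X,Y$ be real Banach spaces, and let $f:X\to Y$ be an $\varepsilon$-nearisometry with $f(0)=0$. Assume further that $f$ maps $X$ $\delta$-onto some closed linear subspace $Y_1\subset Y$. Then there exists a bijective linear isometry $U:X\to Y_1$ such that $$\|f(x)-Ux\|\le 2\varepsilon+2\delta\quad\text{for all }x\in X.$$ This estimate is sharp: for each pair $\varepsilon,\delta\ge 0$ there are real Banach spaces $X,Y$ and an $\varepsilon$-nearisometry $f:X\to Y$ with $f(0)=0$ mapping $X$ $\delta$-onto a closed linear subspace $Y_1\subset Y$ such that for each linear isometry $U:X\to Y_1$ we have $\|f(x)-Ux\|\ge 2\varepsilon+2\delta$ for some $x\in X$.
   Context: All Banach spaces are real. For $\varepsilon\ge 0$, a map $f:X\to Y$ between Banach spaces (not assumed continuous or surjective) is an $\varepsilon$-nearisometry if $|\,\|f(x)-f(y)\|-\|x-y\|\,|\le\varepsilon$ for all $x,y\in X$. For $\delta\ge 0$ and a closed linear subspace $Y_1\subset Y$, a map $f:X\to Y$ maps $X$ $\delta$-onto $Y_1$ if for every $y\in Y_1$ there is $x\in X$ with $\|f(x)-y\|\le\delta$, and for every $u\in X$ there is $v\in Y_1$ with $\|f(u)-v\|\le\delta$. *)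

(* Defs.v *)
From mathcomp Require Import all_boot all_order all_algebra.
From mathcomp Require Import all_classical all_reals all_analysis.
Import Order.TTheory GRing.Theory Num.Theory numFieldNormedType.Exports.

Set Implicit Arguments.
Unset Strict Implicit.
Unset Printing Implicit Defensive.

Local Open Scope classical_set_scope.
Local Open Scope ring_scope.

Definition nearisometry (R : realType) (X Y : normedModType R) (eps : R)
    (f : X -> Y) : Prop :=
  forall x y : X, `| `|f x - f y| - `|x - y| | <= eps.

Definition is_isometry (R : realType) (X Y : normedModType R) (f : X -> Y) : Prop :=
  forall x y : X, `|f x - f y| = `|x - y|.

Definition closed_linear_subspace (R : realType) (Y : normedModType R)
    (Y1 : set Y) : Prop :=
  submod_closed (mem Y1) /\ closed Y1.

Definition maps_onto_within (R : realType) (X Y : normedModType R) (delta : R)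
    (f : X -> Y) (Y1 : set Y) : Prop :=
  (forall y : Y, Y1 y -> exists x : X, `|f x - y| <= delta) /\
  (forall u : X, exists2 v : Y, Y1 v & `|f u - v| <= delta).

(* Main.v *)
Require Import Defs.
From HB Require Import structures.
From mathcomp Require Import all_boot all_order all_algebra.
From mathcomp Require Import all_classical all_reals all_analysis ring lra.
Import Order.TTheory GRing.Theory Num.Theory numFieldNormedType.Exports.

Set Implicit Arguments.
Unset Strict Implicit.
Unset Printing Implicit Defensive.

Local Open Scope classical_set_scope.
Local Open Scope ring_scope.

(** The isometry is [U x = lim 2^-n f(2^n x)]. Convergence, additivity and
    surjectivity follow from the fact that [f] almost preserves midpoints: if [z]
    is the midpoint of [x] and [y], the approximate solution [S p] of
    [f (S p) = f x + f y - f p] is an approximate involution swapping [x] and [y],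
    and a quantitative version of Väisälä's proof of the Mazur-Ulam theorem shows
    that it almost fixes [z], with an error that is [o(|x - y|)]
    for large distances.

    For the sharp constant put [v = f x - U x], choose [z = U u] in [Y1] with
    [|v - z| <= delta], and compare [|f(tu)| - |f(tu) - f x|] with
    [|tu| - |tu - x|]. As [t] tends to infinity, both become one-sided directional
    derivatives of the norm at [z], and superadditivity of the latter gives
    [|z| <= 2 eps + delta].

    The extremal example is a perturbation of an isometric zigzag of the line into
    the plane with the maximum norm, whose bend lies at distance [delta] from the
    diagonal. *)

(** * Approximate preservation of midpoints *)

(* [psi] is the reflection in the midpoint [z]. Replacing [S] by [S \o psi \o S]
   doubles the displacement of [z] (up to the error), although this displacement
   stays bounded by [`|a - b|] plus an error: this is Väisälä's proof of the
   Mazur-Ulam theorem, made quantitative. *)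
Lemma swap_displacement (R : realType) (X : normedModType R) (k : nat)
    (e : R) (a b z : X) (S : X -> X) :
  a + b = z + z -> nearisometry e S -> (forall p, `|S (S p) - p| <= e) ->
  `|S a - b| <= e -> `|S b - a| <= e ->
  `|S z - z| <= (1 / 2) ^+ k * `|a - b| + (4 * (3 / 2) ^+ k - 2) * e.
Proof.
move=> abz.
have bz : b - z = z - a by apply/eqP; rewrite subr_eq addrAC -abz addrC addKr.
have ab : `|a - b| = 2 * `|z - a|.
  have -> : a - b = - ((z - a) *+ 2).
    by rewrite mulr2n -{1}bz addrA subrK opprB.
  by rewrite normrN normrMn mulr_natl.
elim: k e S => [|k IH] e S Sni SS Sa Sb.
  have /ler_normlP[_ Sza] := Sni z a.
  have := ler_distD (S a) (S z) z; have := ler_distD b (S a) z.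
  rewrite bz !expr0; lra.
pose psi (p : X) := a + b - p.
have psiB p q : `|psi p - psi q| = `|p - q|.
  by rewrite distrC /psi opprB addrC addrA subrK.
have psia : psi a = b by rewrite /psi [a + b]addrC addrK.
have psib : psi b = a by rewrite /psi addrK.
have psiK p : psi (psi p) = p by rewrite /psi subKr.
have Su p q : `|S p - S q| <= `|p - q| + e.
  by have /ler_normlP[_] := Sni p q; lra.
have Sl p q : `|p - q| <= `|S p - S q| + e.
  by have /ler_normlP[+ _] := Sni p q; lra.
have Sa' : `|S (psi (S a)) - b| <= 3 * e.
  have := Su (psi (S a)) (psi b); rewrite psiB psib.
  by have := ler_distD (S a) (S (psi (S a))) b; lra.
have Sb' : `|S (psi (S b)) - a| <= 3 * e.
  have := Su (psi (S b)) (psi a); rewrite psiB psia.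
  by have := ler_distD (S b) (S (psi (S b))) a; lra.
have SS' p : `|S (psi (S (S (psi (S p))))) - p| <= 3 * e.
  have := Su (psi (S (S (psi (S p))))) (psi (psi (S p))); rewrite psiB psiK.
  have := SS (psi (S p)); have := SS p.
  by have := ler_distD (S (S p)) (S (psi (S (S (psi (S p)))))) p; lra.
have Sni' : nearisometry (3 * e) (fun p => S (psi (S p))).
  move=> p q; have e0 := le_trans (normr_ge0 _) Sa.
  have := Su (psi (S p)) (psi (S q)); have := Sl (psi (S p)) (psi (S q)).
  rewrite psiB; have := Su p q; have := Sl p q.
  by move=> *; apply/ler_normlP; split; lra.
(* The factors [4 * (3 / 2) ^+ k - 2] solve the recursion [K_(k+1) = (3 * K_k + 2) / 2] with
   [K_0 = 2]: the error [e] is tripled, [2 * e] is lost in the comparison, and the displacement is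
   halved. *)
have {IH} := IH (3 * e) _ Sni' SS' Sa' Sb'.
rewrite ab; have : 2 * `|S z - z| = `|psi (S z) - S z|.
  have -> : psi (S z) - S z = - ((S z - z) *+ 2).
    by rewrite /psi abz mulr2n opprD !opprB addrACA addrA.
  by rewrite normrN normrMn mulr_natl.
have := Sl (psi (S z)) (S z).
have := ler_distD z (S (psi (S z))) (S (S z)); rewrite (distrC z).
have := SS z; rewrite !exprS.
move: (`|S (S z) - z|) => x1; set K2 := (1 / 2) ^+ k * (2 * `|z - a|).
rewrite -[1 / 2 * _ * _]mulrA -/K2; set K3 := (3 / 2) ^+ k.
have -> : (4 * K3 - 2) * (3 * e) = 12 * (K3 * e) - 6 * e by ring.
have -> : (4 * (3 / 2 * K3) - 2) * e = 6 * (K3 * e) - 2 * e by field.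
by lra.
Qed.

(** The number [k] of doublings is free: when [|x - y|] is of order [2 ^+ n], taking [k = n] gives a
    bound of order [(3 / 2) ^+ n], negligible after division by [2 ^+ n]. *)
Lemma nearisometry_midpoint (R : realType) (X Y : normedModType R) (k : nat)
    (c : R) (f : X -> Y) (x y z : X) :
  nearisometry c f ->
  (forall x y z, exists p, `|f p - (f x + f y - f z)| <= c) ->
  x + y = z + z ->
  `|f x + f y - (f z + f z)| <= (1 / 2) ^+ k * `|x - y| + 16 * (3 / 2) ^+ k * c.
Proof.
move=> fni fsurj xyz.
have [S SP] := choice (fsurj x y).
have c0 : 0 <= c by apply: le_trans (fni x x).
have fu p q : `|f p - f q| <= `|p - q| + c.
  by have /ler_normlP[_] := fni p q; lra.
have fl p q : `|p - q| <= `|f p - f q| + c.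
  by have /ler_normlP[+ _] := fni p q; lra.
pose w p := f x + f y - f p.
have wB p q : `|w p - w q| = `|f p - f q|.
  by rewrite distrC /w opprB addrC addrA subrK.
have {}SP p : `|f (S p) - w p| <= c by exact: SP.
have Sni : nearisometry (4 * c) S.
  move=> p q.
  have := ler_distD (w p) (f (S p)) (f (S q)).
  have := ler_distD (w q) (w p) (f (S q)).
  have := ler_distD (f (S p)) (w p) (w q).
  have := ler_distD (f (S q)) (f (S p)) (w q).
  rewrite wB (distrC (w q)) (distrC (w p) (f (S p))).
  have := SP p; have := SP q.
  have := fu p q; have := fl p q; have := fu (S p) (S q); have := fl (S p) (S q).
  by move=> *; apply/ler_normlP; split; lra.
have SS p : `|S (S p) - p| <= 4 * c.
  have := ler_distD (w (S p)) (f (S (S p))) (f p).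
  have : `|w (S p) - f p| = `|f (S p) - w p|.
    by rewrite (distrC (f (S p))) /w addrAC.
  by have := SP p; have := SP (S p); have := fl (S (S p)) p; lra.
have Sx : `|S x - y| <= 4 * c.
  have := fl (S x) y; have := SP x; rewrite /w [f x + _]addrC addrK; lra.
have Sy : `|S y - x| <= 4 * c.
  have := fl (S y) x; have := SP y; rewrite /w addrK; lra.
have := swap_displacement k xyz Sni SS Sx Sy.
have -> : f x + f y - (f z + f z) = w z - f z by rewrite /w opprD addrA.
have := fu (S z) z; have := ler_distD (f (S z)) (w z) (f z).
rewrite (distrC (w z) (f (S z))); have := SP z.
set K2 := _ ^+ k * `|_|; set K3 := (_ / _) ^+ k.
have -> : (4 * K3 - 2) * (4 * c) = 16 * K3 * c - 8 * c by ring.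
lra.
Qed.

(** * The limit isometry: convergence, linearity, surjectivity *)

Lemma cvg0_geometric_bound (R : realType) (V : normedModType R) (C r : R)
    (w : nat -> V) :
  0 <= r < 1 -> (forall n, `|w n| <= C * r ^+ n) -> w @ \oo --> 0.
Proof.
move=> /andP[r0 r1] wC; apply/norm_cvg0P.
have rn : `|r| < 1 by rewrite ger0_norm.
apply: (squeeze_cvgr _ (cvg_cst 0) (cvg_geometric C rn)).
by apply: nearW => n; rewrite normr_ge0 wC.
Qed.

(** Consecutive terms differ by at most [C / 2 * (3 / 4) ^+ n], so the telescoping series converges
    absolutely. *)
Lemma cvg_dyadic_rescaling (R : realType) (V : completeNormedModType R)
    (C : R) (a : nat -> V) :
  (forall n, `|a n + a n - a n.+1| <= C * (3 / 2) ^+ n) ->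
  cvgn (fun n => (1 / 2) ^+ n *: a n).
Proof.
move=> aC; set u := fun n => _.
suff us : cvgn (series (telescope u)).
  have -> : u = (fun n => u 0%N + series (telescope u) n).
    by apply/funext => n; exact: eq_sum_telescope.
  exact: is_cvgD (is_cvg_cst _) us.
apply: normed_cvg.
have r1 : `|3 / 4 : R| < 1 by rewrite ger0_norm; lra.
have uC n : `|telescope u n| <= geometric (C / 2) (3 / 4) n.
  have -> : telescope u n = - ((1 / 2) ^+ n.+1 *: (a n + a n - a n.+1)).
    rewrite /telescope /u /= scalerBr opprB.
    suff -> : (1 / 2 : R) ^+ n.+1 *: (a n + a n) = (1 / 2) ^+ n *: a n by [].
    by rewrite -mulr2n -[a n *+ 2]scaler_nat scalerA exprSr; congr (_ *: _); field.
  rewrite normrN normrZ ger0_norm ?exprn_ge0 ?divr_ge0//.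
  apply: (le_trans (ler_wpM2l _ (aC n))); first by rewrite exprn_ge0 ?divr_ge0.
  have -> : (3 / 4 : R) = (1 / 2) * (3 / 2) by field.
  rewrite /geometric /= [in leRHS]exprMn exprS.
  by set p := (1 / 2 : R) ^+ n; set q := (3 / 2 : R) ^+ n; lra.
apply: (series_le_cvg _ _ uC) (is_cvg_geometric_series _) => //.
by move=> n; apply: le_trans (uC n).
Qed.

Lemma linear_of_midpoint (R : realType) (X Y : normedModType R) (U : X -> Y) :
  is_isometry U -> U 0 = 0 ->
  (forall x y z, x + y = z + z -> U x + U y = U z + U z) ->
  exists L : {linear X -> Y}, L =1 U.
Proof.
move=> Uiso U0 Umid.
have half (x : X) : x = (2^-1 : R) *: x + (2^-1 : R) *: x.
  by rewrite -scalerDl -[in LHS](scale1r x); congr (_ *: _); field.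
have UD x y : U (x + y) = U x + U y.
  by rewrite (Umid x y _ (half (x + y))) -(Umid (x + y) 0) ?U0 addr0.
have UMn n x : U (n%:R *: x) = n%:R *: U x.
  elim: n => [|n IH]; first by rewrite !scale0r.
  by rewrite -natr1 !scalerDl !scale1r UD IH.
have UN x : U (- x) = - U x.
  by apply/eqP; rewrite -subr_eq0 opprK -UD addNr U0.
have UMz m x : U (m%:~R *: x) = m%:~R *: U x.
  by case: m => n; rewrite ?NegzE ?mulrNz ?scaleNr ?UN UMn.
have Unorm x : `|U x| = `|x| by have := Uiso x 0; rewrite U0 !subr0.
have UZ r x : U (r *: x) = r *: U x.
  apply/eqP; rewrite -subr_eq0 -normr_le0; set w := U _ - _.
  have wn n : n%:R * `|w| <= 2 * `|x|.
    (* The integer part of [n * r] cancels exactly and the fractional part costs at most [2 * |x|],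
       whatever [n] is; hence [w = 0]. *)
    pose m := Num.floor (n%:R * r); have /andP[m_le lt_m] := floor_itv (n%:R * r).
    have nr : `|n%:R * r - m%:~R| <= 1.
      by rewrite ger0_norm ?subr_ge0//; rewrite intrD in lt_m; lra.
    have -> : n%:R * `|w| = `|n%:R *: w| by rewrite normrZ normr_nat.
    have -> : n%:R *: w =
        U ((n%:R * r - m%:~R) *: x) - (n%:R * r - m%:~R) *: U x.
      rewrite scalerBr -UMn !scalerA !scalerBl UD UN UMz opprB.
      by rewrite addrA subrK.
    apply: (le_trans (ler_normB _ _)).
    rewrite Unorm !normrZ Unorm.
    have := ler_wpM2r (normr_ge0 x) nr; lra.
  rewrite leNgt; apply/negP => w0.
  have xw : 0 <= 2 * `|x| / `|w| by rewrite divr_ge0 ?mulr_ge0.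
  have := archi_boundP xw; rewrite ltr_pdivrMr// => /lt_le_trans/(_ (wn _)).
  by rewrite ltxx.
have Ulin : linear U by move=> r x y; rewrite UD UZ.
pose UL := GRing.isLinear.Build R X Y *:%R U Ulin.
pose L : {linear X -> Y} := HB.pack U UL.
by exists L.
Qed.

Lemma nearisometry_linear_limit (R : realType) (X : normedModType R)
    (Y : completeNormedModType R) (c : R) (f : X -> Y) :
  nearisometry c f -> f 0 = 0 ->
  (forall x y z, exists p, `|f p - (f x + f y - f z)| <= c) ->
  exists2 U : {linear X -> Y}, is_isometry U &
    forall x, (1 / 2) ^+ n *: f (2 ^+ n *: x) @[n --> \oo] --> U x.
Proof.
move=> fni f0 fsurj.
have h0 n : 0 <= (1 / 2 : R) ^+ n by rewrite exprn_ge0 ?divr_ge0.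
have h2 n : (1 / 2 : R) ^+ n * 2 ^+ n = 1.
  by rewrite -exprMn (_ : 1 / 2 * 2 = 1) ?expr1n//; field.
have h32 n : 1 <= (3 / 2 : R) ^+ n by rewrite exprn_ege1//; lra.
pose u x n := (1 / 2 : R) ^+ n *: f ((2 : R) ^+ n *: x).
have u_cvg x : cvgn (u x).
  apply: (@cvg_dyadic_rescaling _ _ (2 * `|x| + 16 * c)) => n.
  have -> : 2 ^+ n.+1 *: x = 2 ^+ n *: x + 2 ^+ n *: x.
    by rewrite -scalerDl; congr (_ *: _); rewrite exprS; ring.
  have := nearisometry_midpoint n fni fsurj (add0r (2 ^+ n *: x + 2 ^+ n *: x)).
  rewrite f0 add0r distrC sub0r normrN -scalerDl normrZ.
  rewrite ger0_norm ?addr_ge0 ?exprn_ge0// => /le_trans; apply.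
  have -> : (1 / 2) ^+ n * ((2 ^+ n + 2 ^+ n) * `|x|) =
      (1 / 2) ^+ n * 2 ^+ n * (2 * `|x|) by ring.
  rewrite h2 mul1r.
  have := ler_wpM2r (normr_ge0 x) (h32 n); lra.
pose U x := limn (u x).
have uU x : u x @ \oo --> U x by exact: u_cvg.
have h2B n (x y : X) : (1 / 2 : R) ^+ n * `|2 ^+ n *: x - 2 ^+ n *: y| = `|x - y|.
  by rewrite -scalerBr normrZ ger0_norm ?exprn_ge0// mulrA h2 mul1r.
have Uiso : is_isometry U.
  move=> x y.
  have cvg1 : `|u x n - u y n| @[n --> \oo] --> `|U x - U y|.
    exact: cvg_norm (cvgB (uU x) (uU y)).
  apply/eqP; rewrite -subr_eq0; apply/eqP.
  apply: (cvg_unique _ (cvgB cvg1 (cvg_cst _))) => //.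
  apply: (@cvg0_geometric_bound _ _ c (1 / 2)); first lra.
  move=> n; rewrite -[X in `|X| <= _]/(`|u x n - u y n| - `|x - y|).
  rewrite -(h2B n x y) /u -scalerBr normrZ (ger0_norm (h0 n)) -mulrBr normrM.
  rewrite (ger0_norm (h0 n)) mulrC; exact: ler_wpM2r (fni _ _).
have U0 : U 0 = 0.
  apply: (cvg_unique _ (uU 0)) => //.
  rewrite (_ : u 0 = cst 0); first exact: cvg_cst.
  by apply/funext => n; rewrite /u scaler0 f0 scaler0.
have Umid x y z : x + y = z + z -> U x + U y = U z + U z.
  move=> xyz; apply/eqP; rewrite -subr_eq0; apply/eqP.
  apply: (cvg_unique _ (cvgB (cvgD (uU x) (uU y)) (cvgD (uU z) (uU z)))) => //.
  apply: (@cvg0_geometric_bound _ _ (`|x - y| + 16 * c) (3 / 4)); first lra.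
  move=> n; have xyzn : 2 ^+ n *: x + 2 ^+ n *: y = 2 ^+ n *: z + 2 ^+ n *: z.
    by rewrite -!scalerDr xyz.
  have := ler_wpM2l (h0 n) (nearisometry_midpoint n fni fsurj xyzn).
  rewrite -{1}(ger0_norm (h0 n)) -normrZ scalerBr !scalerDr => /le_trans; apply.
  rewrite mulrDr mulrCA h2B.
  have -> : (3 / 4 : R) = (1 / 2) * (3 / 2) by field.
  rewrite [in leRHS]exprMn; set p := (1 / 2 : R) ^+ n; set q := (3 / 2 : R) ^+ n.
  have : 0 <= p * `|x - y| * (q - 1) by rewrite !mulr_ge0 ?h0 ?subr_ge0 ?h32.
  lra.
have [L LU] := linear_of_midpoint Uiso U0 Umid.
exists L; first by move=> x y; rewrite !LU Uiso.
by move=> x; rewrite LU; exact: uU.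
Qed.

(** A preimage of [y] is the limit of [2^-n x_n], where [f x_n] is close to [2^n y]. It exists
    because [x_n] is close to half of [x_(n+1)]: their images nearly agree, by the midpoint estimate
    for [x_(n+1)] and [0]. *)
Lemma nearisometry_limit_onto (R : realType) (X Y : completeNormedModType R)
    (c d : R) (f : X -> Y) (U : X -> Y) (y : Y) :
  nearisometry c f -> f 0 = 0 ->
  (forall x y z, exists p, `|f p - (f x + f y - f z)| <= c) ->
  (forall x, (1 / 2) ^+ n *: f (2 ^+ n *: x) @[n --> \oo] --> U x) ->
  (forall t : R, exists x, `|f x - t *: y| <= d) -> exists x, U x = y.
Proof.
move=> fni f0 fsurj fU fy.
have [x0 xP] := choice (fun n => fy (2 ^+ n)).
pose x n := x0 n; have {}xP n : `|f (x n) - 2 ^+ n *: y| <= d by exact: xP.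
have c0 : 0 <= c by apply: le_trans (fni 0 0).
have d0 : 0 <= d by apply: le_trans (xP 0%N).
have h0 n : 0 <= (1 / 2 : R) ^+ n by rewrite exprn_ge0 ?divr_ge0.
have h2 n : (1 / 2 : R) ^+ n * 2 ^+ n = 1.
  by rewrite -exprMn (_ : 1 / 2 * 2 = 1) ?expr1n//; field.
have h32 n : 1 <= (3 / 2 : R) ^+ n by rewrite exprn_ege1//; lra.
have h1 n : (1 / 2 : R) ^+ n <= 1 by rewrite exprn_ile1 ?divr_ge0//; lra.
have fl p q : `|p - q| <= `|f p - f q| + c.
  by have /ler_normlP[+ _] := fni p q; lra.
have fu p q : `|f p - f q| <= `|p - q| + c.
  by have /ler_normlP[_] := fni p q; lra.
have xn n : `|x n| <= 2 ^+ n * `|y| + d + c.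
  have := fl (x n) 0; rewrite f0 !subr0.
  have := ler_normD (f (x n) - 2 ^+ n *: y) (2 ^+ n *: y); rewrite subrK normrZ.
  by rewrite ger0_norm ?exprn_ge0//; have := xP n; lra.
have x_cvg : cvgn (fun n => (1 / 2 : R) ^+ n *: x n).
  apply: (@cvg_dyadic_rescaling _ _ (2 * `|y| + 4 * d + 19 * c)) => n.
  pose z := (1 / 2 : R) *: x n.+1.
  have zz : z + z = x n.+1.
    by rewrite -scalerDl (_ : 1 / 2 + 1 / 2 = 1 :> R) ?scale1r//; field.
  have mid := nearisometry_midpoint n fni fsurj (etrans (addr0 _) (esym zz)).
  have -> : x n + x n - x n.+1 = (x n - z) *+ 2.
    by rewrite -zz mulr2n opprD addrACA.
  (* The term [3 * d] counts the error of [x n] twice and that of [x n.+1] once. *)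
  have fxz : `|(f (x n) - f z) *+ 2| <= `|f (x n.+1) + f 0 - (f z + f z)| + 3 * d.
    have -> : (f (x n) - f z) *+ 2 = (f (x n.+1) + f 0 - (f z + f z)) +
       ((f (x n) - 2 ^+ n *: y) *+ 2 - (f (x n.+1) - 2 ^+ n.+1 *: y)).
      rewrite f0 addr0 exprS -scalerA scaler_nat !mulrnBl -mulr2n.
      set t := (_ *: y) *+ 2.
      by rewrite opprB [_ + (t - _)]addrA subrK [RHS]addrC addrA subrK.
    apply: (le_trans (ler_normD _ _)); rewrite lerD2l.
    apply: (le_trans (ler_normB _ _)); rewrite normrMn -[X in X + _]mulr_natl.
    by have := xP n; have := xP n.+1; lra.
  have xz := fl (x n) z.
  rewrite normrMn -[leLHS]mulr_natl.
  move: fxz; rewrite normrMn -[leLHS]mulr_natl => fxz.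
  have xSn := ler_wpM2l (h0 n) (xn n.+1).
  have xSn' : (1 / 2) ^+ n * `|x n.+1| <= 2 * `|y| + d + c.
    apply: (le_trans xSn).
    have -> : (1 / 2) ^+ n * (2 ^+ n.+1 * `|y| + d + c) =
        (1 / 2) ^+ n * 2 ^+ n * (2 * `|y|) + (1 / 2) ^+ n * (d + c).
      by rewrite exprS; ring.
    by rewrite h2 (mul1r (2 * _)) -[leRHS]addrA lerD2l ler_piMl ?addr_ge0.
  move: mid; rewrite subr0 => mid.
  have : 0 <= (2 * `|y| + 4 * d + 3 * c) * ((3 / 2) ^+ n - 1).
    by rewrite mulr_ge0 ?subr_ge0 ?addr_ge0 ?mulr_ge0.
  set q := (3 / 2 : R) ^+ n in mid *.
  lra.
exists (limn (fun n => (1 / 2 : R) ^+ n *: x n)); set l := limn _.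
have xl : (1 / 2 : R) ^+ n *: x n @[n --> \oo] --> l by exact: x_cvg.
apply: (cvg_unique _ (fU l)) => //.
apply: cvg_sub0 (cvg_cst y).
apply/norm_cvg0P.
have cv0 : `|l - (1 / 2) ^+ n *: x n| + geometric (c + d) (1 / 2) n
     @[n --> \oo] --> (0 : R).
  rewrite -[X in _ --> X]addr0; apply: cvgD.
    apply/norm_cvg0P; rewrite -[X in _ --> X](subrr l).
    exact: cvgB (cvg_cst _) xl.
  by apply: cvg_geometric; rewrite ger0_norm ?divr_ge0//; lra.
apply: (squeeze_cvgr _ (cvg_cst 0) cv0); apply: nearW => n; rewrite normr_ge0 /=.
rewrite -[X in `|X|]/((1 / 2) ^+ n *: f (2 ^+ n *: l) - y).
have sc (V : normedModType R) (v w : V) :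
    `|(1 / 2 : R) ^+ n *: v - w| = (1 / 2) ^+ n * `|v - 2 ^+ n *: w|.
  rewrite -[in RHS](ger0_norm (h0 n)) -normrZ [in RHS]scalerBr.
  by rewrite [in RHS]scalerA h2 scale1r.
rewrite (distrC l) !sc (distrC _ (2 ^+ n *: l)).
have := ler_wpM2l (h0 n) (fu (2 ^+ n *: l) (x n)).
have := ler_wpM2l (h0 n) (ler_distD (f (x n)) (f (2 ^+ n *: l)) (2 ^+ n *: y)).
have := ler_wpM2l (h0 n) (xP n).
by set p := (1 / 2 : R) ^+ n; lra.
Qed.

(** * The sharp error bound *)

(* For fixed [w] and [y], [t * `|w| - `|t *: w - y|] is nondecreasing in [t]; as
   [t] tends to infinity it tends to the left derivative of the norm at [w] in the
   direction [y], which is superadditive in [y]. Comparing the distances from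
   [2 ^+ n *: u] to [0] and to [x] with those between the images bounds by
   [2 * eps] that derivative at [z = U u] in the direction [f x - U x]. *)
Lemma nearisometry_limit_error (R : realType) (X Y : normedModType R)
    (eps delta : R) (f : X -> Y) (U : {linear X -> Y}) (x u : X) :
  nearisometry eps f -> f 0 = 0 -> is_isometry U ->
  (forall x, (1 / 2) ^+ n *: f (2 ^+ n *: x) @[n --> \oo] --> U x) ->
  `|f x - U x - U u| <= delta -> `|U u| <= 2 * eps + delta.
Proof.
move=> fni f0 Uiso fU; set z := U u => xz.
pose phi (w y : Y) (t : R) := t * `|w| - `|t *: w - y|.
have phi_nd w y s t : s <= t -> phi w y s <= phi w y t.
  move=> st; rewrite /phi; have -> : t *: w - y = (t - s) *: w + (s *: w - y).
    by rewrite scalerBl addrA subrK.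
  have := ler_normD ((t - s) *: w) (s *: w - y).
  rewrite normrZ ger0_norm ?subr_ge0//; lra.
have phi_ub t : 0 <= t -> phi z (U x) t <= `|U x|.
  move=> t0; have := ler_normD (t *: z - U x) (U x).
  rewrite subrK normrZ ger0_norm// /phi; lra.
have h0 n : 0 <= (1 / 2 : R) ^+ n by rewrite exprn_ge0 ?divr_ge0.
have h2 n : (2 : R) ^+ n * (1 / 2) ^+ n = 1.
  by rewrite -exprMn (_ : 2 * (1 / 2) = 1) ?expr1n//; field.
pose q n := (1 / 2 : R) ^+ n *: f ((2 : R) ^+ n *: u).
have qz : q n @[n --> \oo] --> z by exact: fU.
have phi_q n : phi (q n) (f x) (2 ^+ n) <= phi z (U x) (2 ^+ n) + 2 * eps.
  have p0 : 0 <= (2 : R) ^+ n by rewrite exprn_ge0.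
  have fq : 2 ^+ n *: q n = f (2 ^+ n *: u) by rewrite scalerA h2 scale1r.
  have nq : 2 ^+ n * `|q n| = `|f (2 ^+ n *: u)|.
    by rewrite -fq [in RHS]normrZ ger0_norm.
  have nu : `|2 ^+ n *: u| = 2 ^+ n * `|z|.
    by have := Uiso u 0; rewrite linear0 !subr0 normrZ ger0_norm// => ->.
  have nux : `|2 ^+ n *: u - x| = `|2 ^+ n *: z - U x| by rewrite -Uiso linearZ.
  have /ler_normlP[_ fu0] := fni (2 ^+ n *: u) 0.
  have /ler_normlP[+ _] := fni (2 ^+ n *: u) x.
  move: fu0; rewrite /phi f0 !subr0 fq nq nu nux; lra.
(* Superadditivity enters here: adding [z] to the direction and [1] to [r] adds [|z|] to [phi z].
   Replacing [U x + z] by [f x] costs [delta], and replacing [z] by [q n] costs the last term. *)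
have phi_step r n : 0 <= r -> r + 1 <= 2 ^+ n ->
    `|z| - delta + phi z (U x) r <=
    phi z (U x) (2 ^+ n) + 2 * eps + 2 * (r + 1) * `|q n - z|.
  move=> r0 rn; have := phi_nd (q n) (f x) _ _ rn; have := phi_q n.
  have : `|(r + 1) *: q n - f x| <=
      (r + 1) * `|q n - z| + `|r *: z - U x| + delta.
    have -> : (r + 1) *: q n - f x =
        (r + 1) *: (q n - z) + (r *: z - U x) - (f x - U x - z).
      have -> : r *: z - U x = (r + 1) *: z - (U x + z).
        by rewrite scalerDl scale1r [U x + z]addrC opprD addrA addrK.
      rewrite -[f x - U x - z]addrA -opprD.
      by rewrite scalerBr addrA subrK opprB addrA subrK.
    apply: (le_trans (ler_normB _ _)); apply: lerD => //.
    apply: (le_trans (ler_normD _ _)).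
    by rewrite normrZ ger0_norm// addr_ge0.
  have := ler_distD (q n) z 0; rewrite !subr0 (distrC z) => qn.
  have := ler_wpM2l (addr_ge0 r0 ler01) qn.
  rewrite /phi; lra.
(* By monotonicity [sup E] is the limit of [phi z (U x)] at infinity, that is, the one-sided
   derivative. *)
pose E := [set phi z (U x) r | r in [set r | 0 <= r]].
have Eub : has_sup E.
  split; first by exists (phi z (U x) 0); exists 0 => /=.
  by exists `|U x| => _ [r r0 <-]; exact: phi_ub.
have phiE r : 0 <= r -> phi z (U x) r <= sup E.
  by move=> r0; apply: sup_upper_bound => //; exists r.
suff : sup E <= sup E + 2 * eps + delta - `|z| by lra.
apply: ge_sup; first by case: Eub.
move=> _ [r r0 <-].
suff : `|z| - delta + phi z (U x) r <= sup E + 2 * eps by lra.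
have cvgR : sup E + 2 * eps + 2 * (r + 1) * `|q n - z| @[n --> \oo]
    --> sup E + 2 * eps.
  rewrite -[X in _ --> X]addr0; apply: cvgD; first exact: cvg_cst.
  rewrite -[X in _ --> X](mulr0 (2 * (r + 1))); apply: cvgMl_tmp.
  apply/norm_cvg0P; rewrite -[X in _ --> X](subrr z).
  exact: cvgB qz (cvg_cst _).
apply: (ler_cvg_to (cvg_cst _) cvgR).
near=> n.
have rn : r + 1 <= 2 ^+ n.
  have n2 : (n%:R : R) <= 2 ^+ n by rewrite -natrX ler_nat; apply/ltnW/ltn_expl.
  by apply: le_trans n2; near: n; exact: nbhs_infty_ger.
have := phi_step r n r0 rn; have := phiE (2 ^+ n) (exprn_ge0 _ _).
rewrite ler0n => /(_ isT); lra.
Unshelve. all: by end_near. Qed.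

Lemma nearsurjective_nearisometry_approx (R : realType) (eps delta : R)
    (X Y : completeNormedModType R) (f : X -> Y) (Y1 : set Y) :
  0 <= eps -> 0 <= delta ->
  nearisometry eps f -> f 0 = 0 ->
  closed_linear_subspace Y1 -> maps_onto_within delta f Y1 ->
  exists U : {linear X -> Y},
    [/\ is_isometry U, set_bij [set: X] Y1 U &
        forall x : X, `|f x - U x| <= 2 * eps + 2 * delta].
Proof.
move=> eps0 delta0 fni f0 [[Y10 Y1lin] Y1cl] [onto into].
have Y1P r v w : Y1 v -> Y1 w -> Y1 (r *: v + w).
  by move=> v1 w1; apply/set_mem/Y1lin; exact: mem_set.
have Y1Z r v : Y1 v -> Y1 (r *: v).
  by move=> v1; rewrite -[_ *: v]addr0; apply: Y1P => //; exact: set_mem.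
have Y1B v w : Y1 v -> Y1 w -> Y1 (v - w).
  by move=> v1 w1; rewrite addrC -scaleN1r; exact: Y1P.
(* Moving [f x], [f y] and [f z] into [Y1] costs [3 * delta], and hitting the resulting vector costs
   one more. *)
pose c := eps + 4 * delta.
have fnic : nearisometry c f by move=> x y; have := fni x y; rewrite /c; lra.
have fsurj x y z : exists p, `|f p - (f x + f y - f z)| <= c.
  have [[vx vx1 fvx] [vy vy1 fvy]] := (into x, into y).
  have [vz vz1 fvz] := into z.
  have v1 : Y1 (vx + vy - vz) by apply: Y1B => //; rewrite -(scale1r vx); exact: Y1P.
  have [p fp] := onto _ v1; exists p.
  have -> : f p - (f x + f y - f z) = (f p - (vx + vy - vz)) -
      ((f x - vx) + (f y - vy) - (f z - vz)).
    have -> : f x - vx + (f y - vy) - (f z - vz) =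
        f x + f y - f z - (vx + vy - vz).
      rewrite [f x - vx + _]addrACA -opprD (opprD (f z)) (opprD (vx + vy)).
      by rewrite !opprK addrACA.
    by rewrite (opprB _ (vx + vy - vz)) addrA subrK.
  have := ler_normB (f p - (vx + vy - vz)) ((f x - vx) + (f y - vy) - (f z - vz)).
  have := ler_normB ((f x - vx) + (f y - vy)) (f z - vz).
  have := ler_normD (f x - vx) (f y - vy); rewrite /c; lra.
have [U Uiso fU] := nearisometry_linear_limit fnic f0 fsurj.
have U1 x : Y1 (U x).
  have into2 n : exists v, Y1 v /\ `|f ((2 : R) ^+ n *: x) - v| <= delta.
    by have [v] := into (2 ^+ n *: x); exists v.
  have [v vP] := choice into2.
  pose w n := (1 / 2 : R) ^+ n *: v n.
  suff wU : w n @[n --> \oo] --> U x.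
    by apply: closed_cvg Y1cl _ _ wU; apply: nearW => n; apply: Y1Z; case: (vP n).
  apply: cvg_sub0 (fU x); apply: (@cvg0_geometric_bound _ _ delta (1 / 2)).
    by lra.
  move=> n; rewrite -[X in `|X|]/(w n - (1 / 2) ^+ n *: f (2 ^+ n *: x)).
  rewrite distrC -scalerBr normrZ ger0_norm ?exprn_ge0 ?divr_ge0// mulrC.
  by rewrite ler_wpM2r ?exprn_ge0 ?divr_ge0//; case: (vP n).
have Uonto y : Y1 y -> exists x, U x = y.
  move=> y1; apply: (nearisometry_limit_onto fnic f0 fsurj fU (d := delta)).
  by move=> t; exact/onto/Y1Z.
exists U; split => //.
  split=> [x _|x y _ _ Uxy|y /Uonto[x <-]]; [exact: U1| |by exists x].
  by apply/eqP; rewrite -subr_eq0 -normr_eq0 -Uiso Uxy subrr normr0.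
move=> x; have [w w1 fw] := into x.
have [u Uu] := Uonto _ (Y1B _ _ w1 (U1 x)).
have fxU : f x - U x - U u = f x - w by rewrite Uu opprB addrA subrK.
have := nearisometry_limit_error fni f0 Uiso fU (x := x) (u := u) (delta := delta).
rewrite fxU => /(_ fw); have := ler_normD (f x - U x - U u) (U u).
by rewrite subrK fxU; lra.
Qed.

(** * The extremal example in the plane *)

(* The library lacks the join of the pointed and uniform structures on products,
   without which the product is not recognised as a complete space. *)
HB.saturate prod.

Lemma prod_cauchy_cvg (R : realType) (U V : completeNormedModType R)
    (F : set_system (U * V)%type) :
  ProperFilter F -> cauchy F -> cvg F.
Proof.
move=> FF /cauchy_ballP Fc.
have F1 : cvg (fst @ F).
  apply: cauchy_cvg; apply/cauchy_ballP => e e0.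
  rewrite near_map2; apply: filterS (Fc _ e0).
  by move=> [x y] [].
have F2 : cvg (snd @ F).
  apply: cauchy_cvg; apply/cauchy_ballP => e e0.
  rewrite near_map2; apply: filterS (Fc _ e0).
  by move=> [x y] [].
apply/cvg_ex; exists (lim (fst @ F), lim (snd @ F)).
have E : (fun p : U * V => (p.1, p.2)) = id by apply/funext => -[].
have := cvg_pair F1 F2; rewrite E; exact.
Qed.

HB.instance Definition _ (R : realType) (U V : completeNormedModType R) :=
  Uniform_isComplete.Build (U * V)%type (@prod_cauchy_cvg R U V).

Lemma closed_diagonal_subspace (R : realType) :
  closed_linear_subspace [set p : R * R | p.1 = p.2].
Proof.
split.
  split; first exact: mem_set.
  by move=> r p q /set_mem/= p12 /set_mem/= q12; apply: mem_set => /=; rewrite p12 q12.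
have -> : [set p : R * R | p.1 = p.2] = (fun p => p.1 - p.2) @^-1` [set 0].
  apply/seteqP; split=> p /=; first by move=> ->; rewrite subrr.
  by move=> /eqP; rewrite subr_eq0 => /eqP.
apply: closed_comp => [p _|]; last exact: closed_eq.
apply: cvgB; [exact: cvg_fst|exact: cvg_snd].
Qed.

(* [t |-> (zigzag d t, t)] is an isometric embedding for the maximum norm: it
   follows the diagonal for [0 <= t], moves orthogonally to it down to [t = - d],
   and then runs parallel to the diagonal at distance [d]. *)
Definition zigzag (R : realType) (d t : R) : R :=
  if 0 <= t then t else if - d <= t then - t else t + 2 * d.

Lemma zigzag_lipschitz (R : realType) (d s t : R) :
  0 <= d -> `|zigzag d s - zigzag d t| <= `|s - t|.
Proof.
move=> d0; have := ler_norm (s - t); have := ler_norm (t - s).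
rewrite (distrC t) ler_norml /zigzag => ts st.
by case: (leP 0 s) => s0; case: (leP 0 t) => t0;
  case: (leP (- d) s) => sd; case: (leP (- d) t) => td; lra.
Qed.

(* The offset is [e] except at four points: it must vanish at [0], while [2 * e]
   at [- d - e / 2] makes the approximation error there maximal; the other two
   points restore the diagonal points that would otherwise be missed. If [e = 0],
   the points may coincide, but then all offsets are [0]. *)
Definition offset (R : realType) (e d t : R) : R :=
  if (t == 0) || (t == e / 2) then 0
  else if (t == - d - e / 2) || (t == - d - e) then 2 * e else e.

Definition sharp_map (R : realType) (e d t : R) : R * R :=
  (zigzag d t + offset e d t, t + offset e d t).

(** Only the offsets [0] and [2 * e] can differ by more than [e], so positions are recorded for
    these two alone. *)
Lemma offset_cases (R : realType) (e d t : R) : 0 <= e ->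
  [\/ 0 <= t <= e / 2 /\ offset e d t = 0,
      - d - e <= t <= - d - e / 2 /\ offset e d t = 2 * e
    | offset e d t = e].
Proof.
move=> e0; rewrite /offset.
case: ifPn => [/orP[]/eqP -> |_]; first by constructor 1; split=> //; lra.
  by constructor 1; split=> //; lra.
case: ifPn => [/orP[]/eqP -> |_]; first by constructor 2; split=> //; lra.
  by constructor 2; split=> //; lra.
by constructor 3.
Qed.

Lemma zigzag_ge0 (R : realType) (d t : R) : 0 <= t -> zigzag d t = t.
Proof. by rewrite /zigzag => ->. Qed.

Lemma zigzag_leN (R : realType) (d t : R) :
  0 <= d -> t <= - d -> zigzag d t = t + 2 * d.
Proof.
by rewrite /zigzag; case: (leP 0 t); case: (leP (- d) t); lra.
Qed.

Lemma sharp_map_nearisometry (R : realType) (e d : R) : 0 <= e -> 0 <= d ->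
  nearisometry e (sharp_map e d).
Proof.
move=> e0 d0.
(* Here [s - t] is within [e / 2] of [d + e], so the difference [2 * (d + e) - (s - t)] of the first
   coordinates is within [e] of [s - t]. *)
have opp s t : 0 <= s <= e / 2 /\ offset e d s = 0 ->
    - d - e <= t <= - d - e / 2 /\ offset e d t = 2 * e ->
    `| `|sharp_map e d s - sharp_map e d t| - `|s - t| | <= e.
  move=> [/andP[s0 se] ss] [/andP[td te] st].
  rewrite prod_normE /= ss st zigzag_ge0// zigzag_leN//; last lra.
  rewrite [`|s - t|]ger0_norm; last lra.
  rewrite [`|_ + 0 - (t + 2 * d + _)|]ler0_norm; last lra.
  rewrite ler_norml lerBrDr lerBlDr le_max ge_max ler_norml; lra.
have same s t : `|offset e d s - offset e d t| <= e ->
    `| `|sharp_map e d s - sharp_map e d t| - `|s - t| | <= e.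
  move=> st; rewrite prod_normE /=; have zst := zigzag_lipschitz s t d0.
  have sumB (a b a' b' : R) : a + b - (a' + b') = a - a' + (b - b') by ring.
  rewrite !sumB ler_norml lerBrDr lerBlDr le_max ge_max.
  have := ler_normD (zigzag d s - zigzag d t) (offset e d s - offset e d t).
  have := ler_normD (s - t) (offset e d s - offset e d t).
  have := ler_normB (s - t + (offset e d s - offset e d t))
    (offset e d s - offset e d t).
  rewrite addrK => n1 n2 n3; apply/andP; split; last lra.
  by apply/orP; right; lra.
move=> s t; have [sc|sc|sc] := offset_cases d s e0;
  have [tc|tc|tc] := offset_cases d t e0.
all: try (by apply: same; rewrite ler_norml; lra).
  exact: opp.
by rewrite (distrC (sharp_map e d s)) (distrC s); exact: opp.
Qed.

Lemma sharp_map_onto (R : realType) (e d : R) : 0 <= e -> 0 <= d ->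
  maps_onto_within d (sharp_map e d) [set p : R * R | p.1 = p.2].
Proof.
move=> e0 d0; split; last first.
  move=> t; pose v := (zigzag d t + t) / 2 + offset e d t.
  exists (v, v) => //; rewrite prod_normE /= ge_max !ler_norml /v /zigzag.
  by case: (leP 0 t) => t0; case: (leP (- d) t) => td; lra.
move=> [v w] /= <-{w}.
suff [t [P1 P2]] : exists t, `|zigzag d t + offset e d t - v| <= d /\
    `|t + offset e d t - v| <= d.
  by exists t; rewrite prod_normE /= ge_max P1 P2.
(* Generically the offset is [e]: [v - e] hits [(v, v)] exactly if [e < v], and [v - e - d] gives
   [(v + d, v - d)] if [v < e]. The four values treated first are those where such a parameter may
   be exceptional. *)
have [->|v0] := eqVneq v 0.
  by exists 0; rewrite /offset eqxx/= zigzag_ge0// !addr0 subrr normr0.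
have offset_le t : t <= - d -> t < 0 -> offset e d t =
    if (t == - d - e / 2) || (t == - d - e) then 2 * e else e.
  move=> td t0; rewrite /offset (lt_eqF t0).
  by rewrite (_ : t == e / 2 = false)//; apply: lt_eqF; lra.
have [ve|ve] := eqVneq v e.
  rewrite ve in v0 *; have e1 : 0 < e by rewrite lt_neqAle eq_sym v0.
  exists (- d - e); rewrite offset_le ?eqxx ?orbT ?zigzag_leN; try lra.
  by rewrite !ler_norml; lra.
have [ve2|ve2] := eqVneq v (e / 2).
  exists (e / 2); rewrite /offset eqxx orbT zigzag_ge0 ?divr_ge0//.
  by rewrite ve2 addr0 subrr normr0.
have [ve3|ve3] := eqVneq v (3 * e / 2).
  have e1 : 0 < e by rewrite lt_neqAle e0 andbT eq_sym; apply: contra_neq v0 => ?; lra.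
  exists (- d - e / 2); rewrite offset_le ?eqxx/= ?zigzag_leN; try lra.
  by rewrite !ler_norml; lra.
have [lt_ve|le_ev] := ltP v e.
  exists (v - e - d); rewrite offset_le; try lra.
  rewrite ifF; last first.
    apply/negbTE; rewrite negb_or; apply/andP; split.
      by apply: contra_neq ve2 => ?; lra.
    by apply: contra_neq v0 => ?; lra.
  by rewrite zigzag_leN ?ler_norml; lra.
have {}lt_ev : e < v by rewrite lt_neqAle eq_sym ve.
exists (v - e); rewrite zigzag_ge0; last lra.
rewrite /offset gt_eqF ?subr_gt0//= ifF; last first.
  by apply/negbTE; apply: contra_neq ve3 => ?; lra.
rewrite ifF; first by rewrite subrK subrr normr0.
by apply/negbTE; rewrite negb_or !gt_eqF//; lra.
Qed.

Lemma approx_constant_sharp (R : realType) (e d : R) : 0 <= e -> 0 <= d ->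
  exists (X Y : completeNormedModType R) (f : X -> Y) (Y1 : set Y),
    [/\ nearisometry e f, f 0 = 0,
        closed_linear_subspace Y1, maps_onto_within d f Y1 &
        forall U : {linear X -> Y},
          is_isometry U -> set_fun [set: X] Y1 U ->
          exists x : X, 2 * e + 2 * d <= `|f x - U x|].
Proof.
move=> e0 d0.
exists R, (R * R)%type, (sharp_map e d), [set p | p.1 = p.2]; split.
- exact: sharp_map_nearisometry.
- by rewrite /sharp_map /offset eqxx zigzag_ge0// !addr0.
- exact: closed_diagonal_subspace.
- exact: sharp_map_onto.
move=> U Uiso U1.
have UE t : U t = (t * (U 1).2, t * (U 1).2).
  have U12 : (U 1).1 = (U 1).2 by exact: U1.
  have -> : U t = t *: U 1 by rewrite -linearZ [_ *: _]mulr1.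
  by case: (U 1) U12 => a b /= ->.
have : `|(U 1).2| = 1.
  have := Uiso 1 0; rewrite linear0 !subr0 normr1 prod_normE.
  by rewrite (UE 1) /= !mul1r maxxx.
(* [U] is [t |-> (c * t, c * t)] with [c = 1] or [c = -1]. If [c = -1], a large positive [t]
   suffices; if [c = 1], the first coordinate of the error at [- d - e / 2] is [2 * d] from the
   zigzag plus [2 * e] from the offset. *)
case: ler0P => _.
  move=> /eqP; rewrite eqr_oppLR => /eqP c1.
  pose t := 2 * e + 2 * d + 1.
  exists t; rewrite UE prod_normE le_max /= c1 !ler_normr.
  by have [[_ ->]|[_ ->]|->] := offset_cases d t e0; rewrite /t; lra.
move=> c1; exists (- d - e / 2); rewrite UE prod_normE le_max /= c1 ler_normr.
suff -> : offset e d (- d - e / 2) = 2 * e by rewrite zigzag_leN//; lra.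
rewrite /offset eqxx /=; case: ifP => // /orP[]/eqP; lra.
Qed.

Theorem theorem3p2 (R : realType) :
  (forall (eps delta : R) (X Y : completeNormedModType R) (f : X -> Y)
          (Y1 : set Y),
     0 <= eps -> 0 <= delta ->
     nearisometry eps f -> f 0 = 0 ->
     closed_linear_subspace Y1 -> maps_onto_within delta f Y1 ->
     exists U : {linear X -> Y},
       [/\ is_isometry U, set_bij [set: X] Y1 U &
           forall x : X, `|f x - U x| <= 2 * eps + 2 * delta]) /\
  (forall eps delta : R, 0 <= eps -> 0 <= delta ->
     exists (X Y : completeNormedModType R) (f : X -> Y) (Y1 : set Y),
       [/\ nearisometry eps f, f 0 = 0,
           closed_linear_subspace Y1, maps_onto_within delta f Y1 &
           forall U : {linear X -> Y},
             is_isometry U -> set_fun [set: X] Y1 U ->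
             exists x : X, 2 * eps + 2 * delta <= `|f x - U x|]).
Proof.
split; first exact: nearsurjective_nearisometry_approx.
exact: approx_constant_sharp.
Qed.
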